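(* Let $\big((\mathfrak{p}_1,\diamond_1,\lfloor\cdot,\cdot\rfloor_1),(\mathfrak{p}_2,\diamond_2,\lfloor\cdot,\cdot\rfloor_2),l,r,\psi,L,R,\Psi\big)$ be a matched pair of NS-Lie algebras. Then $(\mathfrak{p}_1\oplus\mathfrak{p}_2,\diamond_{\Join},\lfloor\cdot,\cdot\rfloor_{\Join})$ is an NS-Lie algebra, where $$(x,\alpha)\diamond_{\Join}(y,\beta)=\big(x\diamond_1y+L_\alpha y+R_\beta x,\ \alpha\diamond_2\beta+l_x\beta+r_y\alpha\big),$$ $$\lfloor(x,\alpha),(y,\beta)\rfloor_{\Join}=\big(\lfloor x,y\rfloor_1+\Psi_\alpha y-\Psi_\beta x,\ \lfloor\alpha,\beta\rfloor_2+\psi_x\beta-\psi_y\alpha\big),$$ for $(x,\alpha),(y,\beta)\in\mathfrak{p}_1\oplus\mathfrak{p}_2$.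
   Context: An NS-Lie algebra $(\mathfrak{p},\diamond,\lfloor\cdot,\cdot\rfloor)$ is a vector space with bilinear operations $\diamond$ and $\lfloor\cdot,\cdot\rfloor$, the latter antisymmetric, such that, with $\llbracket x,y\rrbracket:=x\diamond y-y\diamond x+\lfloor x,y\rfloor$, $(x\diamond y)\diamond z-x\diamond(y\diamond z)+\lfloor x,y\rfloor\diamond z=(y\diamond x)\diamond z-y\diamond(x\diamond z)$ and $\lfloor x,\llbracket y,z\rrbracket\rfloor+\lfloor y,\llbracket z,x\rrbracket\rfloor+\lfloor z,\llbracket x,y\rrbracket\rfloor+x\diamond\lfloor y,z\rfloor+y\diamond\lfloor z,x\rfloor+z\diamond\lfloor x,y\rfloor=0$. A representation of $(\mathfrak{p},\diamond,\lfloor\cdot,\cdot\rfloor)$ is $(\mathcal{V},l,r,\psi)$ with linear maps $l,r,\psi:\mathfrak{p}\to\mathrm{End}(\mathcal{V})$ such that $l_{x\diamond y}-l_xl_y+l_{\lfloor x,y\rfloor}=l_{y\diamond x}-l_yl_x$; $r_{x\diamond y}-r_yr_x+r_y\psi_x=l_xr_y-r_yl_x$; $\psi_{\llbracket x,y\rrbracket}-r_{\lfloor x,y\rfloor}=l_x\psi_y-l_y\psi_x+\psi_x(l_y-r_y+\psi_y)-\psi_y(l_x-r_x+\psi_x)$. A matched pair of NS-Lie algebras is a tuple as in the claim consisting of two NS-Lie algebras and linear maps $l,r,\psi:\mathfrak{p}_1\to\mathrm{End}(\mathfrak{p}_2)$, $L,R,\Psi:\mathfrak{p}_2\to\mathrm{End}(\mathfrak{p}_1)$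 such that $(\mathfrak{p}_2,l,r,\psi)$ is a representation of $\mathfrak{p}_1$, $(\mathfrak{p}_1,L,R,\Psi)$ is a representation of $\mathfrak{p}_2$, and for all $x,y\in\mathfrak{p}_1$, $\alpha,\beta\in\mathfrak{p}_2$, writing $\theta_x=l_x-r_x+\psi_x$ and $\Theta_\alpha=L_\alpha-R_\alpha+\Psi_\alpha$, and $\llbracket\cdot,\cdot\rrbracket_i$ for the bracket $\llbracket\cdot,\cdot\rrbracket$ of $\mathfrak{p}_i$: $l_x(\alpha\diamond_2\beta)=(l_x\alpha)\diamond_2\beta+\alpha\diamond_2(l_x\beta)+(\psi_x\alpha)\diamond_2\beta-(r_x\alpha)\diamond_2\beta+r_{R_\beta x}\alpha-l_{\Theta_\alpha x}\beta$; $r_x(\llbracket\alpha,\beta\rrbracket_2)=\alpha\diamond_2r_x\beta-\beta\diamond_2r_x\alpha+r_{L_\beta x}\alpha-r_{L_\alpha x}\beta$; $L_\alpha(x\diamond_1y)=(L_\alpha x)\diamond_1y+x\diamond_1(L_\alpha y)+(\Psi_\alpha x)\diamond_1y-(R_\alpha x)\diamond_1y+R_{r_y\alpha}x-L_{\theta_x\alpha}y$; $R_\alpha(\llbracket x,y\rrbracket_1)=x\diamond_1R_\alpha y-y\diamond_1R_\alpha x+R_{l_y\alpha}x-R_{l_x\alpha}y$; $l_x(\lfloor\alpha,\beta\rfloor_2)=\lfloor\theta_x\alpha,\beta\rfloor_2+\lfloor\alpha,\theta_x\beta\rfloor_2+\psi_{\Theta_\beta x}\alpha-\psi_{\Theta_\alpha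 x}\beta+\alpha\diamond_2\psi_x\beta-\beta\diamond_2\psi_x\alpha+r_{\Psi_\alpha x}\beta-r_{\Psi_\beta x}\alpha-\psi_x\llbracket\alpha,\beta\rrbracket_2$; $L_\alpha(\lfloor x,y\rfloor_1)=\lfloor\Theta_\alpha x,y\rfloor_1+\lfloor x,\Theta_\alpha y\rfloor_1+\Psi_{\theta_y\alpha}x-\Psi_{\theta_x\alpha}y+x\diamond_1\Psi_\alpha y-y\diamond_1\Psi_\alpha x+R_{\psi_x\alpha}y-R_{\psi_y\alpha}x-\Psi_\alpha\llbracket x,y\rrbracket_1$. *)

(* Defs.v *)
From HB Require Import structures.
From mathcomp Require Import all_boot all_order all_algebra.

Set Implicit Arguments.
Unset Strict Implicit.
Unset Printing Implicit Defensive.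

Import GRing.Theory.
Local Open Scope ring_scope.

(* Linear maps p -> End(V) are given in curried form f : p -> V -> V, i.e. as
   maps linear in each argument; equations in End(V) are stated pointwise. *)
Definition is_bilinear (k : fieldType) (U V W : lmodType k) (f : U -> V -> W) :
  Prop := bilinear_for *:%R *:%R f.

Section NSLie.
Variables (k : fieldType) (p : lmodType k).
Variables (dia flr : p -> p -> p).

Local Notation "x <o> y" := (dia x y) (at level 40, left associativity).
Local Notation "<| x , y |>" := (flr x y) (at level 0, x, y at level 99).

Definition ns_bracket (x y : p) : p := x <o> y - y <o> x + <|x, y|>.

Local Notation "[[ x , y ]]" := (ns_bracket x y) (at level 0, x, y at level 99).

Record is_NSLie : Prop := IsNSLie {
  NSLie_dia_bilinear : is_bilinear dia;
  NSLie_flr_bilinear : is_bilinear flr;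
  NSLie_flr_antisym : forall x y, <|x, y|> = - <|y, x|>;
  NSLie_dia_ax : forall x y z,
    (x <o> y) <o> z - x <o> (y <o> z) + <|x, y|> <o> z
    = (y <o> x) <o> z - y <o> (x <o> z);
  NSLie_flr_ax : forall x y z,
    <|x, [[y, z]]|> + <|y, [[z, x]]|> + <|z, [[x, y]]|>
    + x <o> <|y, z|> + y <o> <|z, x|> + z <o> <|x, y|> = 0
}.

Section Representation.
Variables (V : lmodType k) (l r psi : p -> V -> V).

Definition rep_theta (x : p) (v : V) : V := l x v - r x v + psi x v.

Record is_NSLie_rep : Prop := IsNSLieRep {
  NSLie_rep_l_linear : is_bilinear l;
  NSLie_rep_r_linear : is_bilinear r;
  NSLie_rep_psi_linear : is_bilinear psi;
  NSLie_rep_l : forall x y v,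
    l (x <o> y) v - l x (l y v) + l <|x, y|> v = l (y <o> x) v - l y (l x v);
  NSLie_rep_r : forall x y v,
    r (x <o> y) v - r y (r x v) + r y (psi x v) = l x (r y v) - r y (l x v);
  NSLie_rep_psi : forall x y v,
    psi [[x, y]] v - r <|x, y|> v
    = l x (psi y v) - l y (psi x v)
      + psi x (l y v - r y v + psi y v) - psi y (l x v - r x v + psi x v)
}.

End Representation.
End NSLie.

Section MatchedPair.
Variables (k : fieldType) (p1 p2 : lmodType k).
Variables (dia1 flr1 : p1 -> p1 -> p1) (dia2 flr2 : p2 -> p2 -> p2).
Variables (l r psi : p1 -> p2 -> p2) (L R Psi : p2 -> p1 -> p1).

Local Notation "x <o1> y" := (dia1 x y) (at level 40, left associativity).
Local Notation "a <o2> b" := (dia2 a b) (at level 40, left associativity).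
Local Notation theta := (rep_theta l r psi).
Local Notation Theta := (rep_theta L R Psi).
Local Notation br1 := (ns_bracket dia1 flr1).
Local Notation br2 := (ns_bracket dia2 flr2).

Record is_matched_pair : Prop := IsMatchedPair {
  mp_NSLie1 : is_NSLie dia1 flr1;
  mp_NSLie2 : is_NSLie dia2 flr2;
  mp_rep1 : is_NSLie_rep dia1 flr1 l r psi;
  mp_rep2 : is_NSLie_rep dia2 flr2 L R Psi;
  mp_l_dia : forall (x : p1) (a b : p2),
    l x (a <o2> b)
    = (l x a) <o2> b + a <o2> (l x b) + (psi x a) <o2> b - (r x a) <o2> b
      + r (R b x) a - l (Theta a x) b;
  mp_r_br : forall (x : p1) (a b : p2),
    r x (br2 a b)
    = a <o2> (r x b) - b <o2> (r x a) + r (L b x) a - r (L a x) b;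
  mp_L_dia : forall (a : p2) (x y : p1),
    L a (x <o1> y)
    = (L a x) <o1> y + x <o1> (L a y) + (Psi a x) <o1> y - (R a x) <o1> y
      + R (r y a) x - L (theta x a) y;
  mp_R_br : forall (a : p2) (x y : p1),
    R a (br1 x y)
    = x <o1> (R a y) - y <o1> (R a x) + R (l y a) x - R (l x a) y;
  mp_l_flr : forall (x : p1) (a b : p2),
    l x (flr2 a b)
    = flr2 (theta x a) b + flr2 a (theta x b)
      + psi (Theta b x) a - psi (Theta a x) b
      + a <o2> (psi x b) - b <o2> (psi x a)
      + r (Psi a x) b - r (Psi b x) a
      - psi x (br2 a b);
  mp_L_flr : forall (a : p2) (x y : p1),
    L a (flr1 x y)
    = flr1 (Theta a x) y + flr1 x (Theta a y)
      + Psi (theta y a) x - Psi (theta x a) y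
      + x <o1> (Psi a y) - y <o1> (Psi a x)
      + R (psi x a) y - R (psi y a) x
      - Psi a (br1 x y)
}.

Definition bowtie_dia (u v : p1 * p2) : p1 * p2 :=
  let: (x, a) := u in let: (y, b) := v in
  (x <o1> y + L a y + R b x, a <o2> b + l x b + r y a).

Definition bowtie_flr (u v : p1 * p2) : p1 * p2 :=
  let: (x, a) := u in let: (y, b) := v in
  (flr1 x y + Psi a y - Psi b x, flr2 a b + psi x b - psi y a).

End MatchedPair.

(* Main.v *)
Require Import Defs.
From HB Require Import structures.
From mathcomp Require Import all_boot all_order all_algebra.

Set Implicit Arguments.
Unset Strict Implicit.
Unset Printing Implicit Defensive.

Import GRing.Theory.
Local Open Scope ring_scope.

(** Write x . y for the first operation and [[x, y]] for the bracket.  Given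
    additivity, the first NS-Lie axiom says that left multiplication turns the
    bracket into a commutator:
      [[x, y]] . z = x . (y . z) - y . (x . z)
    ([dia_axE]).  On the sum of the two algebras the bracket has the shape known
    from matched pairs of Lie algebras,
      [[(x, a), (y, b)]] = ([[x, y]] + Theta_a y - Theta_b x,
                            [[a, b]] + theta_x b - theta_y a),
    where theta = l - r + psi and Theta = L - R + Psi ([bowtie_bracket]).  Both
    axioms on the sum are therefore trilinear identities, and they hold because
    they hold on triples of homogeneous vectors.

    In the component p2 each kind of homogeneous triple gives one hypothesis.
    For the first axiom, three vectors of p2 give the axiom of p2; two vectors
    of p1 and one of p2 give the representation axiom for l or for r, depending
    on the place of the vector of p2; one vector of p1 and two of p2 give the
    compatibility condition for l_x (a . b) or for r_x [[a, b]].  For the second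
    axiom, which is invariant under cyclic permutations, these three cases are
    the axiom of p2, the representation axiom for psi, and the compatibility
    condition for l_x applied to the second operation.  Triples of vectors of p1
    contribute nothing to this component.

    The component p1 is the same computation for the opposite matched pair,
    because the definition of a matched pair is symmetric in the two algebras
    ([is_matched_pair_sym]).

    All homogeneous parts are treated at once in [dia_ax_snd] and [flr_ax_snd]:
    both sides are expanded by additivity, one term of each homogeneous part is
    replaced by means of the corresponding hypothesis, and what remains cancels
    in the free abelian group on the terms.  That cancellation is decided by
    reflection. *)

(** * Deciding linear identities in abelian groups *)

Inductive zterm := ZAtom of nat | ZZero | ZAdd of zterm & zterm | ZOpp of zterm.

Section ZTerm.
Variable V : zmodType.
Implicit Types (env : seq V) (e : zterm).

Fixpoint zeval env e : V :=
  match e with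
  | ZAtom i => env`_i
  | ZZero => 0
  | ZAdd e1 e2 => zeval env e1 + zeval env e2
  | ZOpp e1 => - zeval env e1
  end.

Fixpoint zcoef e (i : nat) : int :=
  match e with
  | ZAtom j => (i == j)%:Z
  | ZZero => 0
  | ZAdd e1 e2 => zcoef e1 i + zcoef e2 i
  | ZOpp e1 => - zcoef e1 i
  end.

Lemma zevalE env e : zeval env e = \sum_(i < size env) env`_i *~ zcoef e i.
Proof.
elim: e => [j||e1 IH1 e2 IH2|e1 IH1] /=.
- have [lt_j|le_j] := ltnP j (size env).
    rewrite (bigD1 (Ordinal lt_j)) //= eqxx big1 ?addr0 // => i ne_ij.
    by move: ne_ij; rewrite -val_eqE /= => /negPf ->.
  rewrite nth_default // big1 // => i _.
  by rewrite ltn_eqF // (leq_trans (ltn_ord i)).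
- by rewrite big1.
- by rewrite IH1 IH2 -big_split /=; apply: eq_bigr => i _; rewrite mulrzDr.
- by rewrite IH1 -sumrN; apply: eq_bigr => i _; rewrite mulrNz.
Qed.

(** Comparing multiplicities decides an identity in all abelian groups, and
    needs only computation with small integers. *)
Lemma zeval_eq env e1 e2 :
    all (fun i => zcoef e1 i == zcoef e2 i) (iota 0 (size env)) ->
  zeval env e1 = zeval env e2.
Proof.
move=> /allP eq_coef; rewrite !zevalE; apply: eq_bigr => i _.
by rewrite (eqP (eq_coef i _)) // mem_iota ltn_ord.
Qed.

End ZTerm.

Ltac zatom_index t env :=
  lazymatch env with
  | t :: _ => constr:(0%N)
  | _ :: ?env' => let n := zatom_index t env' in constr:(S n)
  end.

Ltac zatom_add t env :=
  match env with
  | _ => let _ := zatom_index t env in env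
  | _ => constr:(t :: env)
  end.

Ltac zatoms t env :=
  lazymatch t with
  | ?u + ?v => let env' := zatoms u env in zatoms v env'
  | - ?u => zatoms u env
  | 0 => env
  | _ => zatom_add t env
  end.

Ltac zreify t env :=
  lazymatch t with
  | ?u + ?v =>
      let e1 := zreify u env in let e2 := zreify v env in constr:(ZAdd e1 e2)
  | - ?u => let e := zreify u env in constr:(ZOpp e)
  | 0 => constr:(ZZero)
  | _ => let i := zatom_index t env in constr:(ZAtom i)
  end.

(** The atoms are the maximal subterms whose head is not an operation of the
    group, compared syntactically: hypotheses on them have to be used before. *)
Ltac zmodule :=
  lazymatch goal with
  | |- @eq ?T ?s ?t =>
      let env0 := zatoms s (@nil T) in
      let env := zatoms t env0 in
      let e1 := zreify s env in
      let e2 := zreify t env in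
      exact (@zeval_eq _ env e1 e2 isT)
  end.

(** To derive [u = v] from [s = t] it is enough that the two differences agree;
    when they consist of the same terms, [zmodule] settles this. *)
Lemma eq_trans_subr (V : zmodType) (s t u v : V) :
  s = t -> u - v = s - t -> u = v.
Proof. by move=> ->; rewrite subrr => /subr0_eq. Qed.

(** * Bilinear maps *)

Section Bilinear.
Variables (k : fieldType) (U V W : lmodType k) (f : U -> V -> W).
Hypothesis f_bilin : is_bilinear f.

Lemma bilPl c u u' v : f (c *: u + u') v = c *: f u v + f u' v.
Proof. exact: f_bilin.1. Qed.

Lemma bilPr c u v v' : f u (c *: v + v') = c *: f u v + f u v'.
Proof. exact: f_bilin.2. Qed.

Lemma bilDl u u' v : f (u + u') v = f u v + f u' v.
Proof. by rewrite -[u]scale1r bilPl !scale1r. Qed.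

Lemma bilDr u v v' : f u (v + v') = f u v + f u v'.
Proof. by rewrite -[v]scale1r bilPr !scale1r. Qed.

Lemma bil0l v : f 0 v = 0.
Proof. by apply: (addrI (f 0 v)); rewrite -bilDl !addr0. Qed.

Lemma bil0r u : f u 0 = 0.
Proof. by apply: (addrI (f u 0)); rewrite -bilDr !addr0. Qed.

Lemma bilNl u v : f (- u) v = - f u v.
Proof. by apply: (addrI (f u v)); rewrite -bilDl !subrr bil0l. Qed.

Lemma bilNr u v : f u (- v) = - f u v.
Proof. by apply: (addrI (f u v)); rewrite -bilDr !subrr bil0r. Qed.

Definition bilE := (bilDl, bilDr, bilNl, bilNr).

End Bilinear.

(** * The axioms in terms of the bracket *)

Section NSLieTheory.
Variables (k : fieldType) (p : lmodType k) (dia flr : p -> p -> p).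
Local Notation br := (ns_bracket dia flr).

(** Stated without assuming an NS-Lie algebra, since it is used both to read
    the axiom in the given algebras and to establish it on their sum. *)
Lemma dia_axE : is_bilinear dia -> forall x y z,
    dia (br x y) z = dia x (dia y z) - dia y (dia x z) <->
    dia (dia x y) z - dia x (dia y z) + dia (flr x y) z
    = dia (dia y x) z - dia y (dia x z).
Proof.
move=> bil x y z; rewrite /ns_bracket !(bilE bil).
by split=> E; apply: (eq_trans_subr E); zmodule.
Qed.

Hypothesis p_NSLie : is_NSLie dia flr.

Lemma dia_bracket x y z :
  dia (br x y) z = dia x (dia y z) - dia y (dia x z).
Proof.
apply: (dia_axE (NSLie_dia_bilinear p_NSLie) _ _ _).2.
exact: NSLie_dia_ax p_NSLie _ _ _.
Qed.

Lemma flr_bracket x y z :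
  flr x (br y z)
  = - (flr y (br z x) + flr z (br x y)
       + dia x (flr y z) + dia y (flr z x) + dia z (flr x y)).
Proof.
by apply: (eq_trans_subr (NSLie_flr_ax p_NSLie x y z)); zmodule.
Qed.

Variables (V : lmodType k) (l r psi : p -> V -> V).
Hypothesis V_rep : is_NSLie_rep dia flr l r psi.
Local Notation theta := (rep_theta l r psi).

(** The axiom for [l] is the analogue of [dia_bracket]: [l] is a representation
    of the bracket. *)
Lemma rep_l_bracket x y v : l (br x y) v = l x (l y v) - l y (l x v).
Proof.
rewrite /ns_bracket !(bilE (NSLie_rep_l_linear V_rep)).
by apply: (eq_trans_subr (NSLie_rep_l V_rep x y v)); zmodule.
Qed.

Lemma rep_r_theta x y v : r y (theta x v) = l x (r y v) - r (dia x y) v.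
Proof.
rewrite /rep_theta !(bilE (NSLie_rep_r_linear V_rep)).
by apply: (eq_trans_subr (NSLie_rep_r V_rep x y v)); zmodule.
Qed.

Lemma rep_psi_bracket x y v :
  psi (br x y) v
  = r (flr x y) v + (l x (psi y v) - l y (psi x v))
    + (psi x (theta y v) - psi y (theta x v)).
Proof.
rewrite /rep_theta.
by apply: (eq_trans_subr (NSLie_rep_psi V_rep x y v)); zmodule.
Qed.

End NSLieTheory.

(** * The axioms on the sum, in the second component *)

Section SecondComponent.
Variables (k : fieldType) (p1 p2 : lmodType k).
Variables (dia1 flr1 : p1 -> p1 -> p1) (dia2 flr2 : p2 -> p2 -> p2).
Variables (l r psi : p1 -> p2 -> p2) (L R Psi : p2 -> p1 -> p1).
Hypothesis Hmp : is_matched_pair dia1 flr1 dia2 flr2 l r psi L R Psi.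

Local Notation theta := (rep_theta l r psi).
Local Notation Theta := (rep_theta L R Psi).
Local Notation br1 := (ns_bracket dia1 flr1).
Local Notation br2 := (ns_bracket dia2 flr2).

Let p2_NSLie := mp_NSLie2 Hmp.
Let p2_rep := mp_rep1 Hmp.

Let bilinE := (bilE (NSLie_dia_bilinear p2_NSLie),
  bilE (NSLie_flr_bilinear p2_NSLie), bilE (NSLie_rep_l_linear p2_rep),
  bilE (NSLie_rep_r_linear p2_rep), bilE (NSLie_rep_psi_linear p2_rep)).

(** Solved for [dia2 (theta x a) b], because additivity on the left leaves the
    second component [theta x a] of a mixed bracket as one term. *)
Lemma dia_theta x a b :
  dia2 (theta x a) b
  = l x (dia2 a b) - dia2 a (l x b) - r (R b x) a + l (Theta a x) b.
Proof.
by rewrite (mp_l_dia Hmp) {1}/rep_theta !bilinE; zmodule.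
Qed.

(** In the compatibility condition for [l x (flr2 a b)], antisymmetry turns
    every application of [flr2] to a value of [theta] into one with that value
    on the right; this is the form in which such terms occur in the second
    axiom. *)
Lemma l_flr x a b :
  l x (flr2 a b)
  = flr2 a (theta x b) - flr2 b (theta x a)
    + (psi (Theta b x) a - psi (Theta a x) b)
    + (dia2 a (psi x b) - dia2 b (psi x a))
    + (r (Psi a x) b - r (Psi b x) a) - psi x (br2 a b).
Proof.
by rewrite (mp_l_flr Hmp) (NSLie_flr_antisym p2_NSLie (theta x a)); zmodule.
Qed.

(** The left-hand side is the second component of [[(x, a), (y, b)]] . (z, c). *)
Lemma dia_ax_snd x a y b z c :
    let s := br1 x y + Theta a y - Theta b x in
    let t := br2 a b + theta x b - theta y a in
    let vw := dia2 b c + l y c + r z b in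
    let uw := dia2 a c + l x c + r z a in
  dia2 t c + l s c + r z t
  = dia2 a vw + l x vw + r (dia1 y z + L b z + R c y) a
    - (dia2 b uw + l y uw + r (dia1 x z + L a z + R c x) b).
Proof.
have [[E1 E2] E3] := (dia_bracket p2_NSLie, rep_l_bracket p2_rep, mp_r_br Hmp).
have [E4 E5] := (rep_r_theta p2_rep, dia_theta).
(* Rewriting with additivity sees through definitions: the brackets, [theta]
   and [Theta] are made abstract so that they are not expanded. *)
move: br1 br2 theta Theta E1 E2 E3 E4 E5 => brk1 brk2 th Th E1 E2 E3 E4 E5 /=.
by rewrite !bilinE E1 E2 E3 !E4 !E5; zmodule.
Qed.

(** Second component of the bracketed term of the second axiom, that is, of the
    operation [bowtie_flr] applied to (x, a) and [[(y, b), (z, c)]]. *)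
Let jac_term x a y b z c :=
  let s := br1 y z + Theta b z - Theta c y in
  let t := br2 b c + theta y c - theta z b in
  flr2 a t + psi x t - psi s a.

(** Likewise for [bowtie_dia] applied to (x, a) and the value of [bowtie_flr] at
    (y, b) and (z, c). *)
Let dia_flr_term x a y b z c :=
  let s := flr1 y z + Psi b z - Psi c y in
  let t := flr2 b c + psi y c - psi z b in
  dia2 a t + l x t + r s a.

Lemma flr_ax_snd x a y b z c :
  jac_term x a y b z c + jac_term y b z c x a + jac_term z c x a y b
  + dia_flr_term x a y b z c + dia_flr_term y b z c x a
  + dia_flr_term z c x a y b = 0.
Proof.
rewrite /jac_term /dia_flr_term.
have [[E1 E2] E3] := (flr_bracket p2_NSLie, rep_psi_bracket p2_rep, l_flr).
(* As above, this protects the brackets from the additivity rules. *)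
move: br1 br2 theta Theta E1 E2 E3 => brk1 brk2 th Th E1 E2 E3.
by rewrite !bilinE (E1 a b c) !E2 !E3; zmodule.
Qed.

End SecondComponent.

(** * The sum of a matched pair *)

Section Bowtie.
Variables (k : fieldType) (p1 p2 : lmodType k).
Variables (dia1 flr1 : p1 -> p1 -> p1) (dia2 flr2 : p2 -> p2 -> p2).
Variables (l r psi : p1 -> p2 -> p2) (L R Psi : p2 -> p1 -> p1).

Lemma is_matched_pair_sym :
  is_matched_pair dia1 flr1 dia2 flr2 l r psi L R Psi ->
  is_matched_pair dia2 flr2 dia1 flr1 L R Psi l r psi.
Proof. by case=> *; split. Qed.

Local Notation bd := (bowtie_dia dia1 dia2 l r L R).
Local Notation bf := (bowtie_flr flr1 flr2 psi Psi).

Lemma bowtie_bracket x a y b :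
  ns_bracket (p := (p1 * p2)%type) bd bf (x, a) (y, b)
  = (ns_bracket dia1 flr1 x y + rep_theta L R Psi a y - rep_theta L R Psi b x,
     ns_bracket dia2 flr2 a b + rep_theta l r psi x b - rep_theta l r psi y a).
Proof.
by congr pair; rewrite /= /ns_bracket /rep_theta; zmodule.
Qed.

Hypothesis Hmp : is_matched_pair dia1 flr1 dia2 flr2 l r psi L R Psi.

Let p1_NSLie := mp_NSLie1 Hmp.
Let p2_NSLie := mp_NSLie2 Hmp.
Let p2_rep := mp_rep1 Hmp.
Let p1_rep := mp_rep2 Hmp.

Lemma bowtie_dia_bilinear : is_bilinear (U := (p1 * p2)%type) bd.
Proof.
have [d1 d2] := (NSLie_dia_bilinear p1_NSLie, NSLie_dia_bilinear p2_NSLie).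
have [[bl br] [bL bR]] := ((NSLie_rep_l_linear p2_rep, NSLie_rep_r_linear p2_rep),
  (NSLie_rep_l_linear p1_rep, NSLie_rep_r_linear p1_rep)).
split=> [[y b]|[y b]] c [x a] [x' a']; congr pair => /=.
- by rewrite !(bilPl d1, bilPl bL, bilPr bR) !scalerDr; zmodule.
- by rewrite !(bilPl d2, bilPl bl, bilPr br) !scalerDr; zmodule.
- by rewrite !(bilPr d1, bilPr bL, bilPl bR) !scalerDr; zmodule.
- by rewrite !(bilPr d2, bilPr bl, bilPl br) !scalerDr; zmodule.
Qed.

Lemma bowtie_flr_bilinear : is_bilinear (U := (p1 * p2)%type) bf.
Proof.
have [f1 f2] := (NSLie_flr_bilinear p1_NSLie, NSLie_flr_bilinear p2_NSLie).
have [bp bP] := (NSLie_rep_psi_linear p2_rep, NSLie_rep_psi_linear p1_rep).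
split=> [[y b]|[y b]] c [x a] [x' a']; congr pair => /=.
- by rewrite !(bilPl f1, bilPl bP, bilPr bP) !scalerDr scalerN; zmodule.
- by rewrite !(bilPl f2, bilPl bp, bilPr bp) !scalerDr scalerN; zmodule.
- by rewrite !(bilPr f1, bilPl bP, bilPr bP) !scalerDr scalerN; zmodule.
- by rewrite !(bilPr f2, bilPl bp, bilPr bp) !scalerDr scalerN; zmodule.
Qed.

End Bowtie.

Theorem theorem6p26 (k : fieldType) (p1 p2 : lmodType k)
    (dia1 flr1 : p1 -> p1 -> p1) (dia2 flr2 : p2 -> p2 -> p2)
    (l r psi : p1 -> p2 -> p2) (L R Psi : p2 -> p1 -> p1)
    (Hmp : is_matched_pair dia1 flr1 dia2 flr2 l r psi L R Psi) :
  is_NSLie (p := (p1 * p2)%type)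
    (bowtie_dia dia1 dia2 l r L R) (bowtie_flr flr1 flr2 psi Psi).
Proof.
have Hmp' := is_matched_pair_sym Hmp.
split; [exact: bowtie_dia_bilinear Hmp | exact: bowtie_flr_bilinear Hmp | | |].
- move=> [x a] [y b]; congr pair => /=.
    by rewrite (NSLie_flr_antisym (mp_NSLie1 Hmp) x); zmodule.
  by rewrite (NSLie_flr_antisym (mp_NSLie2 Hmp) a); zmodule.
- move=> [x a] [y b] [z c].
  apply: (dia_axE _ (bowtie_dia_bilinear Hmp) _ _ _).1; rewrite bowtie_bracket.
  congr pair; [exact: (dia_ax_snd Hmp') | exact: (dia_ax_snd Hmp)].
- move=> [x a] [y b] [z c]; rewrite !bowtie_bracket.
  congr pair; [exact: (flr_ax_snd Hmp') | exact: (flr_ax_snd Hmp)].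
Qed.
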